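(* Let $R$ be a ring, let $\mathcal{I}$ be the ideal generated by a set $\{f_k:M_k\to N_k \mid k\in K\}$ of homomorphisms of left $R$-modules, and let $g:U\to V$ be a homomorphism of left $R$-modules. The following are equivalent: 1. $g\in\mathcal{I}^{\perp}$. 2. For every short exact sequence $0\to U\to X\to Y\to 0$, with pushout along $g$ the short exact sequence $0\to V\to Q\to Y\to 0$, for every $k\in K$ and every homomorphism $N_k\to Y$ there is a homomorphism $M_k\to Q$ such that the composition $M_k\to Q\to Y$ equals the composition $M_k\xrightarrow{f_k}N_k\to Y$. 3. For every short exact sequence $0\to V\to Q\to Q/V\to 0$ obtained from a short exact sequence $0\to U\to X\to Y\to 0$ by pushout along $g$, and for every $k\in K$, the composition $$\operatorname{Hom}(N_k,Q/V)\to\operatorname{Hom}(M_k,Q/V)\to\operatorname{Ext}^1(M_k,V)$$ is the zero map, where the first map is precomposition with $f_k$ and the second is the connecting homomorphism of $0\to V\to Q\to Q/V\to0$.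
   Context: $R$ is an arbitrary ring; modules are left $R$-modules. An ideal is an additive subfunctor of $\operatorname{Hom}_R$, i.e. a class $\mathcal{I}$ of $R$-homomorphisms such that for all modules $M,N$ the members of $\mathcal I$ from $M$ to $N$ form a subgroup of $\operatorname{Hom}_R(M,N)$, and $f\circ g\circ h\in\mathcal{I}$ whenever $g\in\mathcal{I}$ and $f,h$ are composable homomorphisms. The ideal generated by a set of homomorphisms is the smallest ideal containing that set. For homomorphisms $i: Z\to Y$ and $j:U\to V$, $\operatorname{Ext}^1(i,j):\operatorname{Ext}^1_R(Y,U)\to\operatorname{Ext}^1_R(Z,V)$ is the map sending (the class of) a short exact sequence $0\to U\to X\to Y\to 0$ to the one obtained by pushout along $j$ followed by pullback along $i$. For an ideal $\mathcal{I}$, $\mathcal{I}^{\perp}=\{j \mid \operatorname{Ext}^1(i,j)=0 \text{ for all } i\in\mathcal{I}\}$. *)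

(* Defs.v *)
From HB Require Import structures.
From mathcomp Require Import all_boot ssralg generic_quotient ring_quotient boolp.

Set Implicit Arguments.
Unset Strict Implicit.
Unset Printing Implicit Defensive.

Import GRing.Theory.
Local Open Scope ring_scope.
Local Open Scope quotient_scope.

(* Rings are [pzRingType]s (the zero ring is allowed); [lmodType R] is the type
   of left R-modules and [{linear M -> N}] that of R-homomorphisms. *)

Section Cokernel.
Variables (R : pzRingType) (A B : lmodType R) (f : {linear A -> B}).

Definition image_pred : {pred B} := fun b => `[< exists a, b = f a >].

Lemma image_predP b : reflect (exists a, b = f a) (b \in image_pred).
Proof. exact: asboolP. Qed.

Lemma image_pred_zmod : zmod_closed image_pred.
Proof.
split=> [|_ _ /image_predP[a ->] /image_predP[b ->]].
  by apply/image_predP; exists 0; rewrite linear0.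
by apply/image_predP; exists (a - b); rewrite linearB.
Qed.

HB.instance Definition _ := GRing.isZmodClosed.Build B image_pred image_pred_zmod.

Definition coker : Type := Quotient.quot (GRing.ZmodClosed.clone B image_pred _).

HB.instance Definition _ := GRing.Zmodule.on coker.

Definition coker_pi (b : B) : coker := \pi_(Quotient.quot _) b.
Definition coker_repr (q : coker) : B := repr q.

Lemma coker_reprK : cancel coker_repr coker_pi.
Proof. exact: reprK. Qed.

Lemma coker_eq b b' : coker_pi b = coker_pi b' <-> exists a, b - b' = f a.
Proof.
split=> [/eqP | H].
  by rewrite /coker_pi -Quotient.idealrBE => /image_predP.
by apply/eqP; rewrite /coker_pi -Quotient.idealrBE; apply/image_predP.
Qed.

Lemma coker_piD : {morph coker_pi : x y / x + y}.
Proof. by move=> x y; rewrite /coker_pi !piE. Qed.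

Definition coker_scale (r : R) (q : coker) : coker := coker_pi (r *: coker_repr q).

Lemma coker_pi_scale r b : coker_scale r (coker_pi b) = coker_pi (r *: b).
Proof.
have /coker_eq[a Ha] := coker_reprK (coker_pi b).
by apply/coker_eq; exists (r *: a); rewrite -scalerBr Ha linearZ.
Qed.

Lemma coker_scaleA a b v :
  coker_scale a (coker_scale b v) = coker_scale (a * b) v.
Proof. by rewrite -[v]coker_reprK !coker_pi_scale scalerA. Qed.

Lemma coker_scale1 : left_id 1 coker_scale.
Proof. by move=> v; rewrite -[v]coker_reprK coker_pi_scale scale1r. Qed.

Lemma coker_scaleDr : right_distributive coker_scale +%R.
Proof.
move=> r u v; rewrite -[u]coker_reprK -[v]coker_reprK.
by rewrite -coker_piD !coker_pi_scale scalerDr coker_piD.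
Qed.

Lemma coker_scaleDl v : {morph coker_scale^~ v : a b / a + b}.
Proof.
by move=> a b; rewrite -[v]coker_reprK !coker_pi_scale scalerDl coker_piD.
Qed.

HB.instance Definition _ := GRing.Zmodule_isLmodule.Build R coker
  coker_scaleA coker_scale1 coker_scaleDr coker_scaleDl.

Lemma coker_pi_linear : linear coker_pi.
Proof. by move=> r u v; rewrite coker_piD -coker_pi_scale. Qed.

HB.instance Definition _ :=
  GRing.isLinear.Build R B coker _ coker_pi coker_pi_linear.

Lemma coker_pi_eq0 b : coker_pi b = 0 <-> exists a, b = f a.
Proof.
by rewrite -[0](linear0 coker_pi); split=> [/coker_eq|[a ->]]; rewrite ?subr0 //;
  apply/coker_eq; exists a; rewrite subr0.
Qed.

Section Lift.
Variables (C : lmodType R) (h : {linear B -> C}) (h0 : forall a, h (f a) = 0).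

Definition coker_lift (_ : forall a, h (f a) = 0) (q : coker) : C :=
  h (coker_repr q).

Lemma coker_lift_pi b : coker_lift h0 (coker_pi b) = h b.
Proof.
have /coker_eq[a Ha] := coker_reprK (coker_pi b).
by apply/eqP; rewrite -subr_eq0 -linearB Ha h0.
Qed.

Lemma coker_lift_linear : linear (coker_lift h0).
Proof.
move=> r u v; rewrite -[u]coker_reprK -[v]coker_reprK -linearP.
by rewrite !coker_lift_pi linearP.
Qed.

HB.instance Definition _ :=
  GRing.isLinear.Build R coker C _ (coker_lift h0) coker_lift_linear.

End Lift.

End Cokernel.

Section FiberProduct.
Variables (R : pzRingType) (A B C : lmodType R).
Variables (f : {linear A -> C}) (g : {linear B -> C}).

Definition fiber_pred : {pred A * B} := fun w => f w.1 == g w.2.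

Lemma fiber_pred_submod : GRing.subsemimod_closed fiber_pred.
Proof.
split; [split|] => [|u v|r u]; rewrite !unfold_in /= ?linear0 //.
  by move=> /eqP Hu /eqP Hv; rewrite !linearD Hu Hv.
by move=> /eqP Hu; rewrite !linearZ /= Hu.
Qed.

HB.instance Definition _ :=
  GRing.isSubmodClosed.Build R (A * B)%type fiber_pred fiber_pred_submod.

Record fiber : Type := Fiber { fiber_val : A * B; _ : fiber_val \in fiber_pred }.

HB.instance Definition _ := [isSub for fiber_val].
HB.instance Definition _ := [Choice of fiber by <:].
HB.instance Definition _ := [SubChoice_isSubLmodule of fiber by <:].

Definition fiber1 (w : fiber) : A := (val w).1.
Definition fiber2 (w : fiber) : B := (val w).2.

Lemma fiberP (w : fiber) : f (fiber1 w) = g (fiber2 w).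
Proof. by apply/eqP; case: w. Qed.

Lemma fiber_ex a b : f a = g b -> exists w, fiber1 w = a /\ fiber2 w = b.
Proof.
move=> H; have Hab : (a, b) \in fiber_pred by apply/eqP.
by exists (@Fiber (a, b) Hab).
Qed.

Lemma fiber_inj (w w' : fiber) :
  fiber1 w = fiber1 w' -> fiber2 w = fiber2 w' -> w = w'.
Proof.
rewrite /fiber1 /fiber2 => H1 H2; apply: val_inj.
by rewrite [val w]surjective_pairing [val w']surjective_pairing H1 H2.
Qed.

Lemma fiber1_linear : linear fiber1.
Proof. by move=> r u v; rewrite /fiber1 linearP. Qed.
HB.instance Definition _ := GRing.isLinear.Build R fiber A _ fiber1 fiber1_linear.

Lemma fiber2_linear : linear fiber2.
Proof. by move=> r u v; rewrite /fiber2 linearP. Qed.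
HB.instance Definition _ := GRing.isLinear.Build R fiber B _ fiber2 fiber2_linear.

Section Lift.
Variables (D : lmodType R) (a : {linear D -> A}) (b : {linear D -> B}).
Variable fg : forall d, f (a d) = g (b d).

Definition fiber_lift (d : D) : fiber :=
  @Fiber (a d, b d) (introT eqP (fg d)).

Lemma fiber_lift_linear : linear fiber_lift.
Proof. by move=> r u v; apply: fiber_inj; rewrite [RHS]linearP; exact: linearP. Qed.
HB.instance Definition _ :=
  GRing.isLinear.Build R D fiber _ fiber_lift fiber_lift_linear.

End Lift.
End FiberProduct.

(* A short exact sequence 0 -> U -> X -> Y -> 0, regarded as an extension of Y
   by U. *)
Record extension (R : pzRingType) (Y U : lmodType R) := Extension {
  ext_mid : lmodType R;
  ext_inj : {linear U -> ext_mid};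
  ext_prj : {linear ext_mid -> Y};
  ext_injective : injective ext_inj;
  ext_exact : forall x, ext_prj x = 0 <-> exists u, x = ext_inj u;
  ext_surjective : forall y, exists x, ext_prj x = y
}.

Arguments ext_mid {R Y U}.
Arguments ext_inj {R Y U}.
Arguments ext_prj {R Y U}.

Section Constructions.
Variable R : pzRingType.
Implicit Types U V X Y Z : lmodType R.

Lemma ext_prj_inj Y U (E : extension Y U) u : ext_prj E (ext_inj E u) = 0.
Proof. by apply/ext_exact; exists u. Qed.

Section Split.
Variables (Y U : lmodType R).

Definition split_inj (u : U) : U * Y := (u, 0).
Lemma split_inj_linear : linear split_inj.
Proof. by move=> r u v; congr pair; rewrite /= scaler0 addr0. Qed.
HB.instance Definition _ :=
  GRing.isLinear.Build R U (U * Y)%type _ split_inj split_inj_linear.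

Definition split_prj (w : U * Y) : Y := w.2.
Lemma split_prj_linear : linear split_prj.
Proof. by []. Qed.
HB.instance Definition _ :=
  GRing.isLinear.Build R (U * Y)%type Y _ split_prj split_prj_linear.

Definition split_ext : extension Y U.
Proof.
apply: (@Extension R Y U (U * Y)%type split_inj split_prj).
- by move=> u v [].
- by move=> [u y]; split=> [/= -> | [v [_ ->]] //]; exists u.
- by move=> y; exists (0, y).
Defined.
End Split.

Section Pushout.
Variables (Y U V : lmodType R) (g : {linear U -> V}) (E : extension Y U).
Local Notation X := (ext_mid E).

(* The pushout of g and U -> X is the cokernel of u |-> (g u, - u); its universal
   property is [po_square], [po_desc_inj], [po_desc_map] and [po_desc_uniq]. *)
Definition po_rel (u : U) : V * X := (g u, - ext_inj E u).
Lemma po_rel_linear : linear po_rel.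
Proof.
by move=> r u v; congr pair; rewrite /= linearP // opprD scalerN.
Qed.
HB.instance Definition _ :=
  GRing.isLinear.Build R U (V * X)%type _ po_rel po_rel_linear.

Definition po_mid : lmodType R := coker po_rel.

Definition po_inj (v : V) : po_mid := coker_pi po_rel (v, 0).
Lemma po_inj_linear : linear po_inj.
Proof.
move=> r u v; rewrite /po_inj -linearP; congr coker_pi; congr pair.
by rewrite /= scaler0 addr0.
Qed.
HB.instance Definition _ := GRing.isLinear.Build R V po_mid _ po_inj po_inj_linear.

Definition po_map (x : X) : po_mid := coker_pi po_rel (0, x).
Lemma po_map_linear : linear po_map.
Proof.
move=> r u v; rewrite /po_map -linearP; congr coker_pi; congr pair.
by rewrite /= scaler0 addr0.
Qed.
HB.instance Definition _ := GRing.isLinear.Build R X po_mid _ po_map po_map_linear.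

Lemma po_square u : po_inj (g u) = po_map (ext_inj E u).
Proof.
apply/coker_eq; exists u.
by congr pair; rewrite /= ?subr0 ?sub0r.
Qed.

Lemma po_elim q : exists v x, q = po_inj v + po_map x.
Proof.
exists (coker_repr q).1, (coker_repr q).2; rewrite -[q in LHS]coker_reprK.
rewrite -[po_inj _ + _]coker_piD; congr coker_pi.
by case: (coker_repr q) => v x; congr pair; rewrite /= ?addr0 ?add0r.
Qed.

Section CoPair.
Variables (W : lmodType R) (a : {linear V -> W}) (b : {linear X -> W}).
Variable ab : forall u, a (g u) = b (ext_inj E u).

Definition po_copair (w : V * X) : W := a w.1 + b w.2.
Lemma po_copair_linear : linear po_copair.
Proof.
by move=> r u v; rewrite /po_copair !linearP scalerDr addrACA.
Qed.
HB.instance Definition _ :=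
  GRing.isLinear.Build R (V * X)%type W _ po_copair po_copair_linear.

Lemma po_copair_rel u : po_copair (po_rel u) = 0.
Proof. by rewrite /po_copair /= linearN ab subrr. Qed.

Definition po_desc : {linear po_mid -> W} := coker_lift po_copair_rel.

Lemma po_desc_inj v : po_desc (po_inj v) = a v.
Proof. by rewrite [LHS]coker_lift_pi /= /po_copair /= linear0 addr0. Qed.
Lemma po_desc_map x : po_desc (po_map x) = b x.
Proof. by rewrite [LHS]coker_lift_pi /= /po_copair /= linear0 add0r. Qed.
Lemma po_desc_sum v x : po_desc (po_inj v + po_map x) = a v + b x.
Proof. by rewrite (linearD po_desc) po_desc_inj po_desc_map. Qed.

Lemma po_desc_uniq (t : {linear po_mid -> W}) :
  (forall v, t (po_inj v) = a v) -> (forall x, t (po_map x) = b x) ->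
  t =1 po_desc.
Proof.
by move=> ta tb q; have [v [x ->]] := po_elim q; rewrite po_desc_sum linearD ta tb.
Qed.
End CoPair.

Lemma po_prj_subproof u : (\0 : {linear V -> Y}) (g u) = ext_prj E (ext_inj E u).
Proof. by rewrite ext_prj_inj. Qed.

Definition po_prj : {linear po_mid -> Y} := po_desc po_prj_subproof.

Lemma po_prj_inj v : po_prj (po_inj v) = 0.
Proof. by rewrite po_desc_inj. Qed.
Lemma po_prj_map x : po_prj (po_map x) = ext_prj E x.
Proof. by rewrite po_desc_map. Qed.

Lemma po_prj_sum v x : po_prj (po_inj v + po_map x) = ext_prj E x.
Proof. by rewrite [LHS]po_desc_sum add0r. Qed.

Definition pushout : extension Y V.
Proof.
apply: (@Extension R Y V po_mid po_inj po_prj).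
- move=> v w /coker_eq[u [Huv /eqP]].
  rewrite subr0 eq_sym oppr_eq0 -(linear0 (ext_inj E)) => /eqP/ext_injective u0.
  by apply/eqP; rewrite -subr_eq0 Huv u0 linear0.
- move=> q; split=> [|[v ->]]; last exact: po_prj_inj.
  have [v [x ->]] := po_elim q.
  rewrite po_prj_sum => /ext_exact[u ->].
  by exists (v + g u); rewrite [RHS]linearD /= po_square.
- move=> y; have [x <-] := ext_surjective E y.
  by exists (po_map x); rewrite po_prj_map.
Defined.

End Pushout.

Section Pullback.
Variables (Z Y U : lmodType R) (i : {linear Z -> Y}) (E : extension Y U).

Definition pb_mid : lmodType R := fiber i (ext_prj E).

Lemma pb_inj_subproof u : i ((\0 : {linear U -> Z}) u) = ext_prj E (ext_inj E u).
Proof. by rewrite ext_prj_inj linear0. Qed.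

Definition pb_inj : {linear U -> pb_mid} := fiber_lift pb_inj_subproof.

Definition pullback : extension Z U.
Proof.
apply: (@Extension R Z U pb_mid pb_inj (fiber1 (f := i) (g := ext_prj E))).
- by move=> u v /(congr1 (@fiber2 _ _ _ _ _ _)) /ext_injective.
- move=> w; split=> [w0|[u ->] //].
  have := fiberP w; rewrite w0 linear0 => /esym/ext_exact[u Hu].
  by exists u; apply: fiber_inj.
- move=> z; have [x Hx] := ext_surjective E (i z).
  by have [w [Hw _]] := fiber_ex (esym Hx); exists w.
Defined.

End Pullback.

(* The short exact sequence 0 -> V -> Q -> Q/V -> 0 of an injection V -> Q. *)
Section Quotient.
Variables (V Q : lmodType R) (j : {linear V -> Q}).

Definition quotient_ext (j_inj : injective j) : extension (coker j) V.
Proof.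
apply: (@Extension R _ V Q j (coker_pi j) j_inj).
- by move=> x; exact: coker_pi_eq0.
- by move=> q; exists (coker_repr q); exact: coker_reprK.
Defined.

End Quotient.

(* Yoneda's Ext^1(Y, U): extensions of Y by U up to isomorphisms inducing the
   identity on Y and U; an element is an equivalence class, as a predicate. *)

Definition ext_equiv Y U (E E' : extension Y U) : Prop :=
  exists phi : {linear ext_mid E -> ext_mid E'},
    [/\ bijective phi,
        forall u, phi (ext_inj E u) = ext_inj E' u &
        forall x, ext_prj E' (phi x) = ext_prj E x].

(* Short five lemma. *)
Lemma ext_equivI Y U (E E' : extension Y U)
    (phi : {linear ext_mid E -> ext_mid E'}) :
  (forall u, phi (ext_inj E u) = ext_inj E' u) ->
  (forall x, ext_prj E' (phi x) = ext_prj E x) -> ext_equiv E E'.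
Proof.
move=> Hi Hp; exists phi; split=> //.
have phi_inj : injective phi.
  move=> x y /eqP; rewrite -subr_eq0 -linearB => /eqP Hxy.
  have /ext_exact[u Hu] : ext_prj E (x - y) = 0 by rewrite -Hp Hxy linear0.
  move: Hxy; rewrite Hu Hi -(linear0 (ext_inj E')) => /ext_injective u0.
  by apply/eqP; rewrite -subr_eq0 Hu u0 linear0.
have phi_surj y : {x | phi x = y}.
  apply: cid; have [x Hx] := ext_surjective E (ext_prj E' y).
  have /ext_exact[u Hu] : ext_prj E' (y - phi x) = 0.
    by rewrite linearB Hp Hx subrr.
  by exists (ext_inj E u + x); rewrite linearD Hi -Hu subrK.
exists (fun y => sval (phi_surj y)) => [x|y]; last by case: (phi_surj y).
by apply: phi_inj; case: (phi_surj (phi x)).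
Qed.

Lemma ext_equiv_refl Y U (E : extension Y U) : ext_equiv E E.
Proof. exact: (@ext_equivI _ _ E E idfun). Qed.

Lemma ext_equiv_sym Y U (E E' : extension Y U) : ext_equiv E E' -> ext_equiv E' E.
Proof.
case=> phi [[psi phiK psiK] Hi Hp].
have psi_lin : linear psi.
  by move=> r x y; apply: (can_inj phiK); rewrite linearP !psiK.
pose psiL : {linear ext_mid E' -> ext_mid E} :=
  HB.pack psi (GRing.isLinear.Build R _ _ _ psi psi_lin).
apply: (@ext_equivI _ _ E' E psiL) => [u|x] /=; first by rewrite -Hi phiK.
by rewrite -Hp psiK.
Qed.

Lemma ext_equiv_trans Y U (E2 E1 E3 : extension Y U) :
  ext_equiv E1 E2 -> ext_equiv E2 E3 -> ext_equiv E1 E3.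
Proof.
case=> phi [_ Hi Hp] [psi [_ Ki Kp]].
by apply: (@ext_equivI _ _ E1 E3 (psi \o phi)) => [u|x] /=;
  rewrite ?Hi ?Ki ?Kp ?Hp.
Qed.

Definition ext1 Y U : Type :=
  {C : extension Y U -> Prop | exists E, C = ext_equiv E}.

Definition ext_class Y U (E : extension Y U) : ext1 Y U :=
  exist _ (ext_equiv E) (ex_intro _ E erefl).

Lemma ext_class_eq Y U (E E' : extension Y U) :
  ext_class E = ext_class E' <-> ext_equiv E E'.
Proof.
split=> [[->]|H]; first exact: ext_equiv_refl.
apply: eq_exist; apply/funext => F; apply/propext.
by split; apply: ext_equiv_trans => //; exact: ext_equiv_sym.
Qed.

Definition ext_repr Y U (c : ext1 Y U) : extension Y U := sval (cid (svalP c)).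

Lemma ext_reprK Y U : cancel (@ext_repr Y U) (@ext_class Y U).
Proof.
by move=> [C HC]; rewrite /ext_repr; case: cid => E /= HE; apply: eq_exist.
Qed.

(* The neutral element of Ext^1(Y, U) for the Baer sum. *)
Definition ext1_zero Y U : ext1 Y U := ext_class (split_ext Y U).

(* Ext^1(i, j). *)
Definition ext1_map Z Y U V (i : {linear Z -> Y}) (j : {linear U -> V})
    (c : ext1 Y U) : ext1 Z V :=
  ext_class (pullback i (pushout j (ext_repr c))).

Lemma pushout_equiv Y U V (j : {linear U -> V}) (E E' : extension Y U) :
  ext_equiv E E' -> ext_equiv (pushout j E) (pushout j E').
Proof.
case=> phi [_ Hi Hp].
have H u : @po_inj Y U V j E' (j u) = (@po_map Y U V j E' \o phi) (ext_inj E u).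
  by rewrite /= Hi po_square.
apply: (@ext_equivI _ _ (pushout j E) (pushout j E') (po_desc H)) => [v|q].
  exact: po_desc_inj.
have [v [x ->]] := po_elim q.
have -> : po_desc H (po_inj j E v + po_map j x) = po_inj j E' v + po_map j (phi x).
  exact: po_desc_sum.
by rewrite [LHS]po_prj_sum [RHS]po_prj_sum.
Qed.

Lemma pullback_equiv Z Y U (i : {linear Z -> Y}) (E E' : extension Y U) :
  ext_equiv E E' -> ext_equiv (pullback i E) (pullback i E').
Proof.
case=> phi [_ Hi Hp].
have H w : i (@fiber1 _ _ _ _ i (ext_prj E) w) = ext_prj E' ((phi \o @fiber2 _ _ _ _ i (ext_prj E)) w).
  by rewrite /= Hp fiberP.
apply: (@ext_equivI _ _ (pullback i E) (pullback i E') (fiber_lift H)) => // u.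
by apply: fiber_inj => //; exact: Hi.
Qed.

(* The value of Ext^1(i, j) does not depend on the representative. *)
Lemma ext1_mapE Z Y U V (i : {linear Z -> Y}) (j : {linear U -> V})
    (E : extension Y U) :
  ext1_map i j (ext_class E) = ext_class (pullback i (pushout j E)).
Proof.
apply/ext_class_eq/pullback_equiv/pushout_equiv/ext_class_eq.
by rewrite ext_reprK.
Qed.

(* The connecting map Hom(M, W) -> Ext^1(M, V) of 0 -> V -> Q -> W -> 0: in
   Yoneda's description it sends h to the pullback of the sequence along h. *)
Definition connecting V W (E : extension W V) (M : lmodType R)
    (h : {linear M -> W}) : ext1 M V :=
  ext_class (pullback h E).

(* Classes of R-homomorphisms. *)
Definition hom_class : Type := forall M N : lmodType R, {linear M -> N} -> Prop.

Record is_ideal (I : hom_class) : Prop := IsIdeal {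
  ideal_zero : forall M N : lmodType R, I M N \0;
  ideal_sub : forall (M N : lmodType R) (f g : {linear M -> N}),
    I M N f -> I M N g -> I M N (f \- g);
  ideal_comp : forall (L M N P : lmodType R) (h : {linear L -> M})
      (g : {linear M -> N}) (f : {linear N -> P}),
    I M N g -> I L P (f \o g \o h)
}.

(* The smallest ideal containing all the f_k. *)
Definition ideal_generated (K : Type) (M N : K -> lmodType R)
    (f : forall k, {linear M k -> N k}) : hom_class :=
  fun A B h =>
    forall J : hom_class, is_ideal J -> (forall k, J (M k) (N k) (f k)) -> J A B h.

Definition perp (I : hom_class) : hom_class :=
  fun U V j =>
    forall (Z Y : lmodType R) (i : {linear Z -> Y}), I Z Y i ->
    forall c : ext1 Y U, ext1_map i j c = ext1_zero Z V.

Lemma ideal_generated_ideal K (M N : K -> lmodType R)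
    (f : forall k, {linear M k -> N k}) : is_ideal (ideal_generated f).
Proof.
split=> [A B J HJ _|A B g h Hg Hh J HJ HfJ|A B C D h g e Hg J HJ HfJ].
- exact: ideal_zero.
- by apply: ideal_sub => //; [exact: Hg | exact: Hh].
- by apply: ideal_comp => //; exact: Hg.
Qed.

End Constructions.

(* Main.v *)
From HB Require Import structures.
Require Import Defs.
From mathcomp Require Import all_boot ssralg boolp.

(** All three conditions are lifting conditions in disguise.  The
    pullback of an extension [E] of [Y] along [h : Z -> Y] represents the zero
    class exactly when [h] lifts through the projection of [E]
    ([pullback_class_eq0]), so [Ext^1(i, g) = 0] says that [i] lifts through
    every pushout along [g] of an extension of its target by [U].

    Asking moreover that all composites [h \o i] lift ([lifts_pushouts]) makes
    this an ideal: lifts can be subtracted and precomposed, and postcomposition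
    is built into the condition ([lifts_pushouts_ideal]).  Hence if the [f k]
    lift, so does the whole ideal that they generate; conversely that ideal
    contains every [h \o f k].  This is the equivalence of the first two
    conditions.

    For the third, the connecting map sends a homomorphism to the class of a
    pullback, so its vanishing on [h \o f k] is again a lifting property, now
    for maps into the cokernel of [V -> Q].  That cokernel is isomorphic to [Y]
    compatibly with the projections from [Q] ([quotient_iso]), which carries
    one lifting property to the other. *)

Set Implicit Arguments.
Unset Strict Implicit.
Unset Printing Implicit Defensive.

Import GRing.Theory.
Local Open Scope ring_scope.

Section Lifting.
Variable R : pzRingType.
Implicit Types U V Y Z : lmodType R.

(** An isomorphism [(u, z) |-> (z, u + t z)] from the split extension to the
    pullback and a lift [t] of [h] determine each other, by the universal
    property of the fiber product. *)
Lemma pullback_class_eq0 Z Y U (h : {linear Z -> Y}) (E : extension Y U) :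
  ext_class (pullback h E) = ext1_zero Z U <->
  exists t : {linear Z -> ext_mid E}, ext_prj E \o t =1 h.
Proof.
rewrite /ext1_zero; split=> [/esym/ext_class_eq[phi [_ _ phi_prj]]|[t ht]].
  have inr_linear : linear (fun z : Z => (0, z) : U * Z).
    by move=> r x y; congr pair; rewrite /= scaler0 addr0.
  pose inr : {linear Z -> (U * Z)%type} :=
    HB.pack (fun z : Z => (0, z) : U * Z)
      (GRing.isLinear.Build R _ _ _ _ inr_linear).
  exists (@fiber2 _ _ _ _ h (ext_prj E) \o phi \o inr) => z /=.
  by rewrite -fiberP; congr (h _); exact: (phi_prj (0, z)).
pose s (w : U * Z) : ext_mid E := ext_inj E w.1 + t w.2.
have s_linear : linear s.
  by move=> r x y; rewrite /s !linearP /= scalerDr addrACA.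
pose sL : {linear (U * Z)%type -> ext_mid E} :=
  HB.pack s (GRing.isLinear.Build R _ _ _ s s_linear).
have hs (w : U * Z) : h (@split_prj _ Z U w) = ext_prj E (sL w).
  by rewrite /= /s linearD /= ext_prj_inj add0r; exact/esym/ht.
apply/esym/ext_class_eq.
apply: (@ext_equivI _ _ _ (split_ext Z U) (pullback h E) (fiber_lift hs)) => //.
by move=> u; apply: fiber_inj => //; rewrite /fiber2 /= /s /= linear0 addr0.
Qed.

(** Quantifying over the maps [h] out of the target, and not just over the
    extensions of [B] itself, gives closure under postcomposition without
    pulling extensions back. *)
Definition lifts_pushouts U V (g : {linear U -> V}) : hom_class R :=
  fun A B i => forall Y (E : extension Y U) (h : {linear B -> Y}),
    exists t : {linear A -> ext_mid (pushout g E)},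
      ext_prj (pushout g E) \o t =1 h \o i.

Lemma lifts_pushouts_ideal U V (g : {linear U -> V}) :
  is_ideal (lifts_pushouts g).
Proof.
split=> [A B|A B i j Hi Hj|A B C D i j l Hj] Y E h.
- by exists \0 => a; move: (pushout g E) => F /=; rewrite !linear0.
- move: (Hi Y E h) (Hj Y E h); move: (pushout g E) => F [t ht] [s hs].
  exists (t \- s) => a /=; rewrite !linearB.
  by congr (_ - _); [exact: ht|exact: hs].
- have [t ht] := Hj Y E (h \o l : {linear _ -> _}).
  by exists (t \o i : {linear _ -> _}) => a; exact: ht.
Qed.

(** The projection of [E] kills exactly the image of [U], so the map that it
    induces on the cokernel is injective as well as surjective; choosing
    preimages inverts it. *)
Lemma quotient_iso Y U (E : extension Y U) :
  exists e : {linear coker (ext_inj E) -> Y},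
  exists e' : {linear Y -> coker (ext_inj E)},
    [/\ cancel e e', cancel e' e &
        forall x, e (coker_pi (ext_inj E) x) = ext_prj E x].
Proof.
pose e : {linear coker (ext_inj E) -> Y} := coker_lift (ext_prj_inj E).
have e_pi x : e (coker_pi (ext_inj E) x) = ext_prj E x by exact: coker_lift_pi.
have e_inj : injective e.
  move=> p q; rewrite -[p]coker_reprK -[q]coker_reprK !e_pi => /eqP.
  by rewrite -subr_eq0 -linearB => /eqP/ext_exact/coker_eq.
have e_surj y : {q | e q = y}.
  by apply: cid; have [x <-] := ext_surjective E y; exists (coker_pi _ x).
pose e' y := sval (e_surj y).
have e'K : cancel e' e by move=> y; exact: svalP (e_surj y).
have e'_linear : linear e'.
  by move=> r x y; apply: e_inj; rewrite linearP !e'K.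
pose e'L : {linear Y -> coker (ext_inj E)} :=
  HB.pack e' (GRing.isLinear.Build R _ _ _ e' e'_linear).
exists e, e'L.
by split=> // q; apply: e_inj; exact: e'K.
Qed.

End Lifting.

Theorem lemma3p3 (R : pzRingType) (K : Type) (M N : K -> lmodType R)
    (f : forall k : K, {linear M k -> N k})
    (U V : lmodType R) (g : {linear U -> V}) :
  let P1 := perp (ideal_generated f) g in
  let P2 :=
    forall (Y : lmodType R) (E : extension Y U) (k : K) (h : {linear N k -> Y}),
      exists t : {linear M k -> ext_mid (pushout g E)},
        ext_prj (pushout g E) \o t =1 h \o f k in
  let P3 :=
    forall (Y : lmodType R) (E : extension Y U) (k : K)
      (h : {linear N k -> coker (ext_inj (pushout g E))}),
      connecting (quotient_ext (@ext_injective _ _ _ (pushout g E)))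
        (h \o f k : {linear M k -> _}) = ext1_zero (M k) V in
  (P1 <-> P2) /\ (P2 <-> P3).
Proof.
move=> P1 P2 P3; split; split.
- move=> perp_g Y E k h.
  (* Ideals absorb two-sided composites; the identity on the right makes
     [h \o f k] one of them. *)
  pose hf : {linear M k -> Y} := h \o f k \o idfun.
  have hf_gen : ideal_generated f hf.
    by move=> J HJ Jf; exact: (ideal_comp HJ idfun h (Jf k)).
  by apply/(pullback_class_eq0 hf); rewrite -ext1_mapE; exact: perp_g.
- move=> lift_f Z Y i gen_i c.
  have lift_i : lifts_pushouts g i.
    by apply: gen_i (lifts_pushouts_ideal g) _ => k Y' E h; exact: lift_f.
  rewrite -[c]ext_reprK ext1_mapE.
  exact/pullback_class_eq0/(lift_i _ (ext_repr c) idfun).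
- move=> lift_f Y E k h.
  have [e [e' [eK e'K e_pi]]] := quotient_iso (pushout g E).
  have [t ht] := lift_f Y E k (e \o h : {linear _ -> _}).
  apply/(pullback_class_eq0 (h \o f k : {linear M k -> _})).
  by exists t => m; apply: (can_inj eK); rewrite [LHS]e_pi; exact: ht.
- move=> conn0 Y E k h.
  have [e [e' [eK e'K e_pi]]] := quotient_iso (pushout g E).
  have /pullback_class_eq0[t ht] := conn0 Y E k (e' \o h : {linear _ -> _}).
  exists t => m; rewrite -[RHS]e'K; apply: etrans (congr1 e (ht m)).
  exact/esym/e_pi.
Qed.
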